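(* Let $(X,\tau,\le)$ be a Noetherian Priestley space and $f\colon X\setminus I(f)\to X$ a partially continuous self-map such that $I(f)$ is clopen. Then $h_{\mathrm{top}}(f)=0$. In particular, the topological entropy of any continuous self-map of a Noetherian Priestley space is $0$.
   Context: A Priestley space is a partially ordered set $(X,\le)$ with a quasi-compact topology such that whenever $y\not\le x$ there is a clopen down-set containing $x$ but not $y$; it is compact Hausdorff. It is Noetherian if every decreasing sequence of closed down-sets is eventually stationary. No order-preservation of $f$ is assumed. A partially continuous self-map is a continuous map $f\colon X\setminus I(f)\to X$ with $I(f)\subset X$ closed. Its entropy: put $\xi_0=X$, $\xi_n=\{x\in X\setminus I(f): f(x)\in\xi_{n-1}\}$; for a symmetric entourage $\mathcal E$ of the canonical uniform structure (all neighbourhoods of the diagonal) and $x\in\xi_n$, $B^n_{\mathcal E}(x)=\{y\in\xi_n:(f^i(x),f^i(y))\in\mathcal E, 0\le i\le n\}$; $S(n,\mathcal E)$ is the maximal cardinality of $E\subset\xi_n$ with $x\notin B^n_{\mathcal E}(y)$ for distinct $x,y\in E$; $h_{\mathrm{top}}(f)=\sup_{\mathcal E}\limsup_n\frac1n\log S(n,\mathcal E)$ (and $-\infty$ if some $\xi_n$ is empty). For continuous $f$ ($I(f)=\emptyset$) this is the usual topological entropy.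
   Formalization: The formal statement assumes every ξ_n is nonempty (for continuous f: X nonempty), since otherwise h_top(f) = −∞ by convention; e.g. X a single point with I(f) = X has ξ_1 = ∅, so the claim h_top(f) = 0 fails. *)

(* Defs.v *)
From HB Require Import structures.
From mathcomp Require Import all_boot all_order all_algebra.
From mathcomp Require Import all_classical all_reals all_analysis.
Set Implicit Arguments. Unset Strict Implicit. Unset Printing Implicit Defensive.
Import Order.TTheory GRing.Theory Num.Theory.
Local Open Scope classical_set_scope.
Local Open Scope ring_scope.

Section Priestley.
Context {X : topologicalType}.

Definition is_partial_order (le : X -> X -> Prop) :=
  [/\ forall x, le x x,
      forall x y, le x y -> le y x -> x = y &
      forall x y z, le x y -> le y z -> le x z].

Definition down_set (le : X -> X -> Prop) (U : set X) :=
  forall x y, le y x -> U x -> U y.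

Definition priestley_space (le : X -> X -> Prop) :=
  [/\ is_partial_order le,
      compact [set: X] &
      forall x y, ~ le y x ->
        exists U : set X, [/\ clopen U, down_set le U, U x & ~ U y]].

Definition noetherian (le : X -> X -> Prop) :=
  forall F : nat -> set X,
    (forall n, closed (F n) /\ down_set le (F n)) ->
    (forall n, F n.+1 `<=` F n) ->
    exists N, forall n, (N <= n)%N -> F n = F N.

(* partially continuous self-map: f is only relevant on X \ I *)
Definition partially_continuous (I : set X) (f : X -> X) :=
  closed I /\ {within ~` I, continuous f}.

Fixpoint xi (I : set X) (f : X -> X) (n : nat) : set X :=
  match n with
  | 0 => [set: X]
  | n.+1 => [set x | ~ I x /\ xi I f n (f x)]
  end.

(* symmetric entourage of the canonical uniform structure:
   a symmetric neighbourhood of the diagonal in X * X *)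
Definition sym_entourage (E : set (X * X)) :=
  (forall x : X, nbhs (x, x) E) /\ (forall x y, E (x, y) -> E (y, x)).

Definition bowen_ball (I : set X) (f : X -> X) (n : nat) (E : set (X * X))
  (x : X) : set X :=
  [set y | xi I f n y /\ forall i, (i <= n)%N -> E (iter i f x, iter i f y)].

Variable R : realType.

Definition sep_number (I : set X) (f : X -> X) (n : nat) (E : set (X * X))
  : \bar R :=
  ereal_sup [set (k%:R)%:E | k in [set k : nat | exists g : 'I_k -> X,
     (forall i, xi I f n (g i)) /\
     (forall i j, i != j -> ~ bowen_ball I f n E (g j) (g i))]].

Definition lnE (x : \bar R) : \bar R :=
  match x with
  | EFin r => (ln r)%:E
  | +oo%E => +oo%E
  | -oo%E => -oo%E
  end.

Definition htop (I : set X) (f : X -> X) : \bar R :=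
  if `[< exists n, xi I f n = set0 >] then -oo%E
  else ereal_sup [set limn_esup
                        (fun n : nat => ((n%:R)^-1)%:E * lnE (sep_number I f n E))%E
                 | E in sym_entourage].

End Priestley.

(* Main.v *)
(** In a Noetherian Priestley space every principal down-set is clopen and the
order is well founded. A separated set is controlled by the itineraries of
points through finitely many clopen sets [A]. If the number of itineraries
through [A] grew exponentially, the Sauer-Shelah lemma would give shattered
sets of times of positive density, and a ballot argument followed by
compactness an infinite set [J] of times all of whose 0-1 patterns are
realised. Call a set big if it realises all patterns on [J] extending some
finite pattern. The whole space is big and a union of two non-big sets is not
big, so there is a minimal [y] whose down-set is big; fixing one more
coordinate of the pattern differently from the itinerary of [y] leaves a big
compact set covered by the down-sets of points below [y], a contradiction. As
[I] is clopen, the partial map extends continuously by the identity on [I],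
which only enlarges separated sets. *)
Require Import Defs.
From mathcomp Require Import all_boot all_order all_algebra.
From mathcomp Require Import all_classical all_reals all_analysis.
From mathcomp Require Import zify lra.
Set Implicit Arguments. Unset Strict Implicit. Unset Printing Implicit Defensive.
Import Order.TTheory GRing.Theory Num.Theory.
Local Open Scope classical_set_scope.
Local Open Scope ring_scope.

(** * Compactness and selection principles *)

(** If [Q A] failed, the sets whose complement in [A] satisfies [Q] would form a proper filter
    containing [A]; its cluster point in [A] contradicts the local hypothesis. *)
Lemma compact_ind (T : topologicalType) (A : set T) (Q : set T -> Prop) :
  compact A -> Q set0 ->
  (forall B C, Q B -> Q C -> Q (B `|` C)) ->
  (forall B C, B `<=` C -> Q C -> Q B) ->
  (forall x, A x -> exists2 U, nbhs x U & Q U) -> Q A.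
Proof.
move=> cA Q0 QU Qsub Qloc; apply: contrapT => nQA.
pose F : set_system T := [set B | Q (A `\` B)].
have nF0 : ~ F set0 by rewrite /F/= setD0.
have FF : ProperFilter F.
  split=> //; split.
  - by rewrite /F/= setDT.
  - by move=> B C; rewrite /F/= => QB QC; rewrite setDIr; exact: QU.
  - by move=> B C BC; apply: Qsub => x [Ax nCx]; split=> // /BC.
have FA : F A by rewrite /F/= setDv.
have [p [Ap clFp]] := cA F FF FA.
have [U pU QU'] := Qloc p Ap.
have FU : F (~` U) by apply: Qsub QU' => x [_ /contrapT].
by have [x [nUx Ux]] := clFp _ _ FU pU.
Qed.

(** Call a finite prefix viable ([Ext]) if for every [n] it extends to a sequence satisfying [P n].
    By monotonicity in [n], one of the two one-bit extensions of a viable prefix is viable; a chosen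
    chain of prefixes defines the limit. *)
Lemma konig (P : nat -> (nat -> bool) -> Prop) :
  (forall n J J', (forall i, (i < n)%N -> J i = J' i) -> P n J -> P n J') ->
  (forall m n J, (m <= n)%N -> P n J -> P m J) ->
  (forall n, exists J, P n J) -> exists J, forall n, P n J.
Proof.
move=> Pext Pmono Pex.
pose Ext (s : seq bool) := forall n, exists J, P n J /\
  forall i, (i < size s)%N -> J i = nth false s i.
have Ext_rcons s : Ext s -> exists b, Ext (rcons s b).
  move=> Es; apply: contrapT => /forallNP nE.
  have /existsNP[n0 n0P] := nE false.
  have /existsNP[n1 n1P] := nE true.
  have [J [PJ Js]] := Es (maxn n0 n1).
  have EJ i : (i < size (rcons s (J (size s))))%N ->
      J i = nth false (rcons s (J (size s))) i.
    rewrite size_rcons ltnS nth_rcons leq_eqVlt => /predU1P[->|ltis].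
      by rewrite ltnn eqxx.
    by rewrite ltis Js.
  case: (J (size s)) EJ => EJ.
    by apply: n1P; exists J; split=> //; apply: Pmono PJ; rewrite leq_maxr.
  by apply: n0P; exists J; split=> //; apply: Pmono PJ; rewrite leq_maxl.
pose T := {s | Ext s}.
have E0 : Ext [::] by move=> n; have [J PJ] := Pex n; exists J.
have /choice[g gP] : forall t : T, exists t' : T,
    exists b, sval t' = rcons (sval t) b.
  case=> s Es; have [b Eb] := Ext_rcons s Es.
  by exists (exist _ _ Eb), b.
pose u n := sval (iter n g (exist _ _ E0)).
have size_u n : size (u n) = n.
  elim: n => // n IHn; rewrite /u iterS; have [b ->] := gP (iter n g (exist _ _ E0)).
  by rewrite size_rcons IHn.
have nth_u n i : (i < n)%N -> nth false (u n) i = nth false (u i.+1) i.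
  elim: n => // n IHn; rewrite ltnS leq_eqVlt => /predU1P[->//|ltin].
  rewrite -IHn// /u iterS; have [b ->] := gP (iter n g (exist _ _ E0)).
  by rewrite nth_rcons -/(u n) size_u ltin.
exists (fun i => nth false (u i.+1) i) => n.
have [J [PJ Ju]] := svalP (iter n g (exist _ _ E0)) n.
apply: Pext PJ => i ltin; rewrite Ju -/(u n) ?size_u//; exact: nth_u.
Qed.

(** * Dense and shattered sets of times *)

(** Density on one long interval may vanish in a limit, density of all prefixes survives. The price
    is half the density and a suffix of length at least [N / (2 q)]. *)
Lemma ballot (J : nat -> bool) (N q : nat) :
  (N < q * \sum_(i < N) J i)%N ->
  exists k, [/\ (k <= N)%N, (N <= 2 * q * (N - k))%N &
    forall j, (j <= N - k)%N -> (j <= 2 * q * \sum_(i < j) J (k + i)%N)%N].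
Proof.
move=> dense; pose S i := (\sum_(l < i) J l)%N.
have SD k j : S (k + j)%N = (S k + \sum_(i < j) J (k + i)%N)%N.
  by rewrite /S big_split_ord.
have sum_le k j : (\sum_(i < j) J (k + i)%N <= j)%N.
  apply: (@leq_trans (\sum_(i < j) 1)%N); last by rewrite sum1_card card_ord.
  by apply: leq_sum => i _; case: (J _).
pose G (k : 'I_N.+1) := (2 * q * S k + (N - k))%N.
(* The suffix of [J] starting at a minimiser of [2 q S k - k] is dense in all
   its prefixes; [N] is added to avoid truncated subtraction. *)
have [k _ kmin] := @arg_minnP _ ord0 predT G isT.
have leN : (k <= N)%N by rewrite -ltnS.
have step j : (j <= N - k)%N ->
    (j <= 2 * q * \sum_(i < j) J (k + i)%N)%N.
  move=> lej; have ltkj : (k + j < N.+1)%N by lia.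
  have := kmin (Ordinal ltkj) isT; rewrite /G/= SD mulnDr.
  by set a := (_ * S k)%N; set b := (_ * \sum_(i < j) _)%N; lia.
exists k; split=> //.
(* Against index 0, minimality gives [2 q S k <= k], so more than half of the mass [q S N > N] lies
   in the suffix, where the mass is at most [q (N - k)]. *)
have := kmin ord0 isT; rewrite /G/= /S big_ord0 -/(S k) subn0.
have := SD k (N - k)%N; have := sum_le k (N - k)%N; rewrite subnKC//.
move: dense; rewrite -/(S N).
move: (\sum_(i < N - k) _)%N => s cS les SN Sk.
have := leq_mul (leqnn q) les; move: cS Sk; rewrite SN mulnDr -!mulnA.
by set a := (q * s)%N; set b := (q * S k)%N; set c := (q * (N - k))%N; lia.
Qed.

Definition tuple_shatters n (W : {set n.-tuple bool}) (J : nat -> bool) :=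
  forall phi : nat -> bool, exists2 w, w \in W &
    forall i, (i < n)%N -> J i -> nth false w i = phi i.

(* Sauer-Shelah, weighted by [t] so that no sum of binomials appears. *)
Lemma sauer (K : realFieldType) (t : K) (n d : nat) (W : {set n.-tuple bool}) :
  0 < t <= 1 ->
  (forall J, tuple_shatters W J -> (\sum_(i < n) J i <= d)%N) ->
  #|W|%:R * t ^+ d <= (1 + t) ^+ n.
Proof.
move=> /andP[t0 t1].
elim: n d W => [|n IHn] d W Wd.
  rewrite expr0 mulr_ile1 ?ler0n ?exprn_ge0 ?exprn_ile1 ?(ltW t0)//.
  by rewrite lern1 (leq_trans (max_card _))// card_tuple expn0.
pose W_ b : {set n.-tuple bool} := [set w | cons_tuple b w \in W]%SET.
have cardW : #|W| = (#|W_ false :|: W_ true| + #|W_ false :&: W_ true|)%N.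
  have cons_inj b : injective (@cons_tuple n bool b).
    by move=> u v /(congr1 val)/= [uv]; exact: val_inj.
  rewrite cardsUI -(card_imset _ (@cons_inj false)) -(card_imset _ (@cons_inj true)).
  rewrite -cardsUI [X in (_ + X)%N](_ : _ = 0%N) ?addn0; last first.
    apply/eqP; rewrite cards_eq0; apply/eqP/setP => w; rewrite finset.in_set0.
    by apply/negP; rewrite inE => /andP[/imsetP[u _ ->] /imsetP[v _]] /(congr1 val).
  apply: eq_card => w; rewrite inE.
  apply/idP/orP.
    case/tupleP: w => -[] w wW; [right|left]; apply/imsetP; exists w => //;
      by rewrite inE.
  by case=> /imsetP[u]; rewrite inE => uW ->.
have shU J : tuple_shatters (W_ false :|: W_ true)%SET J ->
    (\sum_(i < n) J i <= d)%N.
  move=> shJ; pose J' i := if i is i'.+1 then J i' else false.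
  suff /Wd : tuple_shatters W J' by rewrite big_ord_recl/=.
  move=> phi; have [w wU wphi] := shJ (phi \o succn).
  have [b wb] : exists b, cons_tuple b w \in W.
    by move: wU; rewrite !inE => /orP[]; [exists false|exists true].
  by exists (cons_tuple b w) => // -[//|i]; exact: wphi.
have shI J : tuple_shatters (W_ false :&: W_ true)%SET J ->
    (\sum_(i < n) J i < d)%N.
  move=> shJ; pose J' i := if i is i'.+1 then J i' else true.
  suff /Wd : tuple_shatters W J' by rewrite big_ord_recl/=.
  move=> phi; have [w wI wphi] := shJ (phi \o succn).
  exists (cons_tuple (phi 0%N) w); last by case=> [//|i]; exact: wphi.
  by move: wI; rewrite !inE => /andP[]; case: (phi 0%N).
(* The union of the two sections shatters no set larger than [W] does, and
   anything shattered by their intersection is shattered by [W] after adding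
   the first coordinate, which saves one factor [t]. *)
rewrite cardW natrD mulrDl exprSr mulrDr mulr1 lerD ?IHn//.
have [->|/set0Pn[w wI]] := eqVneq (W_ false :&: W_ true)%SET finset.set0.
  by rewrite cards0 mul0r mulr_ge0 ?exprn_ge0 ?addr_ge0 ?(ltW t0).
(* A non-empty family shatters the empty set, so [d] is positive and [d.-1] is a genuine
   predecessor. *)
have d0 : (0 < d)%N.
  apply: leq_ltn_trans (leq0n _) (shI (fun=> false) _).
  by move=> phi; exists w.
rewrite -(prednK d0) exprSr mulrA ler_pM2r//; apply: IHn => J /shI.
by rewrite -{1}(prednK d0).
Qed.

Definition shatters (T : Type) (c : T -> nat -> bool) (n : nat)
    (J : nat -> bool) :=
  forall phi : nat -> bool, exists x,
    forall i, (i < n)%N -> J i -> c x i = phi i.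

Definition itinerary (T : Type) (A : set T) (F : T -> T) (x : T) (i : nat) : bool :=
  `[< A (iter i F x) >].

Definition words (T : Type) (A : set T) (F : T -> T) (n : nat)
    : {set n.-tuple bool} :=
  [set w : n.-tuple bool |
    `[< exists x, forall i, (i < n)%N -> nth false w i = itinerary A F x i >]]%SET.

(** Replacing [x] by [iter k F x] shifts a suffix to time 0, so [ballot] yields shattered sets dense
    in every prefix, a property that [konig] carries to the limit. *)
Lemma shatters_infinite (T : Type) (A : set T) (F : T -> T) (q : nat) :
  (forall N0, exists N J, [/\ (N0 <= N)%N, shatters (itinerary A F) N J &
     (N < q * \sum_(i < N) J i)%N]) ->
  exists J, (forall n, shatters (itinerary A F) n J) /\
    (forall n, exists2 i, (n <= i)%N & J i).
Proof.
move=> dense.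
pose P n J := shatters (itinerary A F) n J /\
  forall j, (j <= n)%N -> (j <= 2 * q * \sum_(i < j) J i)%N.
have [||n|J PJ] := @konig P.
- move=> n J J' JJ' [shJ cJ]; split.
    by move=> phi; have [x xphi] := shJ phi; exists x => i ltin;
      rewrite -JJ'//; exact: xphi.
  move=> j lejn; apply: (leq_trans (cJ j lejn)); rewrite leq_mul2l.
  by apply/orP; right; apply: leq_sum => i _; rewrite JJ'// (leq_trans (ltn_ord i)).
- move=> m n J lemn [shJ cJ]; split.
    by move=> phi; have [x xphi] := shJ phi; exists x => i ltim;
      apply: xphi; exact: leq_trans lemn.
  by move=> j lejm; apply: cJ; exact: leq_trans lemn.
- have [N [J [leN shJ cJ]]] := dense (2 * q * n)%N.
  have [k [lek Nk ck]] := ballot cJ.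
  have lenk : (n <= N - k)%N.
    have q0 : (0 < q)%N by case: (q) cJ => //; rewrite mul0n.
    by rewrite -(@leq_pmul2l (2 * q)) ?muln_gt0// (leq_trans leN).
  exists (fun i => J (k + i)%N); split; last first.
    by move=> j lejn; apply: ck; exact: leq_trans lenk.
  move=> phi; have [x xphi] := shJ (fun i => phi (i - k)%N).
  exists (iter k F x) => i ltin Ji.
  rewrite /itinerary -iterD addnC -/(itinerary A F x (k + i)) xphi//.
    by rewrite addKn.
  by rewrite -ltn_subRL (leq_trans ltin).
exists J; split=> [n|n]; first exact: (PJ n).1.
apply: contrapT => nJ.
(* With no element from [n] on, [J] has at most [n] elements among the first [2 q n + 1] times, too
   few for the density. *)
have [_ /(_ _ (leqnn _))] := PJ (2 * q * n).+1.
apply/negP; rewrite -ltnNge ltnS leq_mul2l; apply/orP; right.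
have -> : (2 * q * n).+1 = (n + ((2 * q * n).+1 - n))%N.
  have q0 : (0 < q)%N.
    by have [N [J' [_ _]]] := dense 0%N; case: (q) => //; rewrite mul0n.
  by nia.
rewrite big_split_ord/= [X in (_ + X)%N]big1 ?addn0.
  apply: (@leq_trans (\sum_(i < n) 1)%N); last by rewrite sum1_card card_ord.
  by apply: leq_sum => i _; case: (J _).
move=> i _; apply/eqP; rewrite eqb0; apply/negP => Ji.
by apply: nJ; exists (n + i)%N; rewrite ?leq_addr.
Qed.

(** * Big sets *)

Definition big (T : Type) (c : T -> nat -> bool) (J : nat -> bool) (K : set T) :=
  exists n phi0, forall m phi, (forall i, (i < n)%N -> phi i = phi0 i) ->
    exists2 x, K x & forall i, (i < m)%N -> J i -> c x i = phi i.

Lemma big_sub (T : Type) (c : T -> nat -> bool) (J : nat -> bool) (K L : set T) :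
  K `<=` L -> big c J K -> big c J L.
Proof.
move=> KL [n [phi0 Kphi]]; exists n, phi0 => m phi /(Kphi m)[x Kx xphi].
by exists x => //; exact: KL.
Qed.

(** If [K] is not big, some finite pattern [phi] extending [phi0] is missed by [K]; every further
    extension of [phi] must then be realised in [L]. *)
Lemma big_setU (T : Type) (c : T -> nat -> bool) (J : nat -> bool) (K L : set T) :
  big c J (K `|` L) -> big c J K \/ big c J L.
Proof.
move=> [n [phi0 KLphi]]; have [|nK] := pselect (big c J K); [by left|right].
have /existsNP[m /existsNP[phi /not_implyP[phiE nphi]]] :
    ~ forall m phi, (forall i, (i < n)%N -> phi i = phi0 i) ->
      exists2 x, K x & forall i, (i < m)%N -> J i -> c x i = phi i.
  by move=> h; apply: nK; exists n, phi0.
exists (maxn n m), phi => m' phi' phi'E.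
have [|x [Kx|Lx] xphi] := KLphi (maxn m m') phi'.
- by move=> i ltin; rewrite phi'E ?phiE// leq_max ltin.
- case: nphi; exists x => // i ltim Ji.
  by rewrite xphi ?phi'E// leq_max ltim ?orbT.
- by exists x => // i ltim; apply: xphi; rewrite leq_max ltim orbT.
Qed.

(** * Minimality and compactness in Noetherian Priestley spaces *)

Lemma noetherian_min (X : topologicalType) (le : X -> X -> Prop)
    (P : set X -> Prop) :
  noetherian le -> (forall D, P D -> closed D /\ down_set le D) ->
  (exists D, P D) ->
  exists2 D, P D & forall D', P D' -> D' `<=` D -> D' = D.
Proof.
move=> noeth Pcd [D0 PD0]; apply: contrapT => nmin.
have /choice[g gP] : forall D : {D | P D}, exists D' : {D | P D},
    sval D' `<=` sval D /\ sval D' <> sval D.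
  case=> D PD; apply: contrapT => nD; apply: nmin; exists D => // D' PD' D'D.
  by apply: contrapT => neD; apply: nD; exists (exist _ _ PD').
pose u n := iter n g (exist _ _ PD0).
have [||N uN] := noeth (fun n => sval (u n)).
- by move=> n; exact/Pcd/(svalP (u n)).
- by move=> n; exact: (gP (u n)).1.
- by apply: (gP (u N)).2; exact: (uN N.+1 (leqnSn N)).
Qed.

Section NoetherianPriestley.
Context {X : topologicalType} {le : X -> X -> Prop}.
Hypotheses (pX : priestley_space le) (nX : noetherian le).

(** A minimal clopen down-set containing [y] has no point outside the principal one: a separating
    clopen down-set would cut it further. *)
Lemma down_clopen y : clopen [set x | le x y].
Proof.
have [[le_refl _ le_trans] _ sep] := pX.
pose P D := [/\ clopen D, down_set le D & D y].
have [||D [cD dD Dy] minD] := @noetherian_min X le P nX.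
- by move=> D [[]].
- by exists setT; split=> //; exact: clopenT.
suff -> : [set x | le x y] = D by [].
apply/seteqP; split=> [x lexy|x Dx]; first exact: dD Dy.
apply: contrapT => nlexy.
have [U [cU dU Uy nUx]] := sep y x nlexy.
have PDU : P (D `&` U).
  split; [exact: clopenI| |by split].
  by move=> a b leba [Da Ua]; split; [exact: dD Da|exact: dU Ua].
by have := minD _ PDU (@subIsetl _ _ _); move: Dx => /[swap] <- [].
Qed.

Lemma not_big_independent (c : X -> nat -> bool) (J : nat -> bool) :
  (forall i b, clopen [set x | c x i = b]) ->
  (forall n, exists2 i, (n <= i)%N & J i) -> ~ big c J setT.
Proof.
have [[le_refl le_anti le_trans] cX _] := pX.
move=> cc Jinf bigT.
have nbig0 : ~ big c J set0.
  by move=> [n [phi0 /(_ 0%N phi0 (fun _ _ => erefl))[]]].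
(* The principal down-sets of points of [K] are open and cover [K]; were none of them big,
   compactness and [big_setU] would make [K] not big. *)
have compact_big (K : set X) : closed K -> big c J K ->
    exists2 z, K z & big c J [set x | le x z].
  move=> clK bigK; apply: contrapT => nz.
  have : compact K by apply: subclosed_compact cX _.
  move=> /(@compact_ind _ _ (fun K => ~ big c J K))/(_ nbig0); apply => //.
  - by move=> A B nA nB /big_setU[].
  - by move=> A B AB nB /(big_sub AB).
  - move=> x Kx; exists [set z | le z x].
      by apply: open_nbhs_nbhs; split; [exact: (down_clopen x).1|exact: le_refl].
    by move=> bigx; apply: nz; exists x.
have clT : closed [set: X] by exact: closedT.
pose P D := exists2 y, D = [set x | le x y] & big c J D.
have [||_ [y -> bigy] miny] := @noetherian_min X le P nX.
- move=> _ [y -> _]; split; first exact: (down_clopen y).2.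
  by move=> a b leba leay; exact: le_trans leay.
- by have [z _ bigz] := compact_big _ clT bigT; exists [set x | le x z], z.
have [n [phi0 yphi]] := bigy.
have [j lenj Jj] := Jinf n.
(* Since [n <= j], the prefix [phi0] leaves coordinate [j] free, and it can be set opposite to the
   value at [y]. *)
pose phi1 i := if i == j then ~~ c y j else phi0 i.
pose K := [set x | le x y] `&` [set x | c x j = ~~ c y j].
have clK : closed K by apply: closedI; [exact: (down_clopen y).2|exact: (cc _ _).2].
have bigK : big c J K.
  exists j.+1, phi1 => m phi phiE.
  (* The window is enlarged to contain [j], which forces the realising point into [K]. *)
  have [|x lexy xphi] := yphi (maxn m j.+1) phi.
    move=> i ltin; rewrite phiE ?ltnS; last by rewrite ltnW// (leq_trans ltin).
    by rewrite /phi1 ltn_eqF// (leq_trans ltin).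
  exists x; last by move=> i ltim; apply: xphi; rewrite leq_max ltim.
  by split=> //=; rewrite xphi ?phiE ?leq_max ?ltnSn ?orbT// /phi1 eqxx.
have [z [lezy cz] bigz] := compact_big _ clK bigK.
(* Minimality makes the two down-sets equal, hence [z = y], although [z] and [y] differ at
   coordinate [j]. *)
have zy : [set x | le x z] = [set x | le x y].
  apply: miny; first by exists z.
  by move=> x lexz; exact: le_trans lezy.
have zE : z = y by apply: le_anti => //;
  have : [set x | le x z] y by rewrite zy; exact: le_refl.
by move: cz; rewrite zE /=; case: (c y j).
Qed.

(** Compactness of the square: near a diagonal point [E] itself works with the empty list; near any
    other point a single clopen down-set separates the two coordinates, and this persists in a
    neighbourhood. *)
Lemma clopen_separation (E : set (X * X)) : (forall x : X, nbhs (x, x) E) ->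
  exists2 l : seq (set X), (forall U, U \in l -> clopen U) &
    forall x y, (forall U, U \in l -> U x <-> U y) -> E (x, y).
Proof.
move=> Ediag; have [[_ le_anti _] cX sep] := pX.
pose Q (K : set (X * X)) := exists2 l : seq (set X),
  (forall U, U \in l -> clopen U) &
  forall x y, K (x, y) -> (forall U, U \in l -> U x <-> U y) -> E (x, y).
suff [l cl lE] : Q (setT `*` setT) by exists l => // x y; exact: lE.
apply: compact_ind.
- exact: compact_setX.
- by exists [::].
- move=> B C [lB cB BE] [lC cC CE]; exists (lB ++ lC).
    by move=> U; rewrite mem_cat => /orP[/cB|/cC].
  move=> x y [Bxy|Cxy] lxy; [apply: BE|apply: CE] => // U Ul; apply: lxy;
    by rewrite mem_cat Ul ?orbT.
- by move=> B C BC [l cl lE]; exists l => // x y /BC; exact: lE.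
move=> [x y] _; have [<-|nxy] := pselect (x = y).
  by exists E => //; exists [::].
have sepQ U : clopen U -> U x <-> ~ U y -> exists2 V, nbhs (x, y) V & Q V.
  move=> cU Uxy; exists [set p | U p.1 <-> ~ U p.2]; last first.
    exists [:: U]; first by move=> V; rewrite inE => /eqP->.
    by move=> a b /= Uab /(_ U (mem_head _ _)); tauto.
  have nbU z : nbhs z [set w | U w <-> U z].
    have [Uz|nUz] := pselect (U z).
      by apply: (@filterS _ _ _ U); [|apply: open_nbhs_nbhs; split=> //; exact: cU.1].
    apply: (@filterS _ _ _ (~` U)); first by move=> w /= nUw; tauto.
    by apply: open_nbhs_nbhs; split=> //; exact: closed_openC cU.2.
  exists ([set w | U w <-> U x], [set w | U w <-> U y]).
    by split; exact: nbU.
  by move=> [a b] /= [ax byy]; tauto.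
have [lexy|nlexy] := pselect (le x y).
  have nleyx : ~ le y x by move=> ?; apply: nxy; exact: le_anti.
  have [U [cU _ Ux nUy]] := sep x y nleyx.
  by apply: (sepQ U) => //; tauto.
have [U [cU _ Uy nUx]] := sep y x nlexy.
by apply: (sepQ U) => //; tauto.
Qed.

Lemma shatters_sparse (A : set X) (F : X -> X) (q : nat) :
  clopen A -> continuous F ->
  exists N0, forall N J, (N0 <= N)%N -> shatters (itinerary A F) N J ->
    (q * \sum_(i < N) J i <= N)%N.
Proof.
move=> cA cF; apply: contrapT => nsparse.
have [|J [shJ Jinf]] := @shatters_infinite X A F q.
  move=> N0; have /forallNP/(_ N0)/existsNP[N /existsNP[J]] := nsparse.
  move=> /not_implyP[leN /not_implyP[shJ]].
  by move=> /negP; rewrite -ltnNge => ltN; exists N, J.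
apply: (@not_big_independent (itinerary A F) J) => //.
  move=> i b; have cFi : continuous (iter i F).
    elim: i => [|i IHi] x; first exact: cvg_id.
    by apply: (@continuous_comp _ _ _ (iter i F) F); [exact: IHi|exact: cF].
  have cAi : clopen (iter i F @^-1` A) by exact: preimage_clopen.
  case: b.
    rewrite (_ : [set x | _] = iter i F @^-1` A)//.
    by apply/seteqP; split=> x /asboolP.
  rewrite (_ : [set x | _] = ~` (iter i F @^-1` A)); first exact: clopenC.
  by apply/seteqP; split=> x /= => [/negbT/asboolPn|/asboolF].
(* Shattering on all windows is bigness of the whole space relative to the empty pattern. *)
exists 0%N, (fun=> false) => m phi _.
by have [x xphi] := shJ m phi; exists x.
Qed.

End NoetherianPriestley.

(** * Subexponential word counts and zero entropy *)

(** With [t = exp (- s)], [sauer] gives [#|W| t^d <= (1 + t)^N <= exp (t N)]. Both [t N] and [s d]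
    are at most [e N / 2], the latter because shattered sets are sparse. *)
Lemma card_words_le (R : realType) (X : topologicalType) (le : X -> X -> Prop)
    (A : set X) (F : X -> X) (e : R) :
  priestley_space le -> noetherian le -> clopen A -> continuous F -> 0 < e ->
  exists N0, forall N, (N0 <= N)%N -> #|words A F N|%:R <= expR (e * N%:R).
Proof.
move=> pX nX cA cF e0.
(* The second argument gives [t <= e / 2], the first gives [t <= 1]. *)
pose s : R := Num.max 0 (- ln (e / 2)).
have s0 : 0 <= s by rewrite le_max lexx.
have te : expR (- s) <= e / 2.
  rewrite -[leRHS]lnK ?posrE ?divr_gt0// ler_expR lerNl.
  by rewrite le_max lexx orbT.
have t01 : 0 < expR (- s) <= 1.
  by rewrite expR_gt0 -[leRHS]expR0 ler_expR oppr_le0.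
pose q := (Num.bound (s / (e / 2))).
have sq : s <= e / 2 * q%:R.
  rewrite mulrC -ler_pdivrMr ?divr_gt0//.
  by apply/ltW/archi_boundP; rewrite divr_ge0// ltW// divr_gt0.
have [N0 sparse] := shatters_sparse pX nX q.+1 cA cF.
exists N0 => N leN.
have /(sauer t01) : forall J, tuple_shatters (words A F N) J ->
    (\sum_(i < N) J i <= N %/ q.+1)%N.
  move=> J shJ; rewrite leq_divRL// mulnC; apply: sparse => // phi.
  have [w] := shJ phi; rewrite inE => /asboolP[x xw] wphi.
  by exists x => i ltiN Ji; rewrite -xw// wphi.
set d := (N %/ q.+1)%N => Wd.
have dN : s * d%:R <= e / 2 * N%:R.
  have qd : (q * d <= N)%N.
    by rewrite (leq_trans _ (leq_divM N q.+1))// mulnC leq_mul.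
  apply: (@le_trans _ _ (e / 2 * q%:R * d%:R)); first by rewrite ler_wpM2r.
  by rewrite -mulrA ler_wpM2l ?divr_ge0 ?(ltW e0)// -natrM ler_nat.
have : #|words A F N|%:R * expR (- s * d%:R) <= expR (e / 2 * N%:R).
  rewrite !expRM_natr; apply: (le_trans Wd).
  apply: lerXn2r; rewrite ?nnegrE ?expR_ge0 ?addr_ge0 ?expR_ge0//.
  by apply: le_trans (expR_ge1Dx _); rewrite lerD2l.
rewrite mulNr expRN -ler_pdivlMr ?invr_gt0 ?expR_gt0// invrK -expRD.
move=> /le_trans; apply; rewrite ler_expR.
by rewrite [in leRHS](splitr e) mulrDl lerD2l.
Qed.

(** Each point is encoded by its family of words, one for each set of [l]; separation makes the
    encoding injective. *)
Lemma separated_card_le (T : Type) (F : T -> T) (l : seq (set T)) (n m : nat)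
    (g : 'I_m -> T) :
  (forall i j, i != j -> exists A p, [/\ A \in l, (p < n)%N &
     itinerary A F (g i) p != itinerary A F (g j) p]) ->
  (m <= \prod_(u < size l) #|words (nth set0 l u) F n|)%N.
Proof.
move=> sep.
pose h i : {ffun 'I_(size l) -> n.-tuple bool} :=
  [ffun u : 'I_(size l) =>
    mktuple (fun p : 'I_n => itinerary (nth set0 l u) F (g i) p)].
have h_inj : injective h.
  move=> i j hij; apply/eqP; apply/contraT => /sep[A [p [Al ltpn]]].
  have ltAl : (index A l < size l)%N by rewrite index_mem.
  move: hij => /(congr1 (fun f : {ffun _} =>
    tnth (f (Ordinal ltAl)) (Ordinal ltpn))).
  by rewrite !ffunE !tnth_mktuple/= nth_index// => ->; rewrite eqxx.
rewrite -{1}(card_ord m) -(card_codom h_inj).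
rewrite (_ : (\prod_(u < _) _)%N =
  #|family (fun u : 'I_(size l) => mem (words (nth set0 l u) F n))|); last first.
  by rewrite card_family foldrE big_image.
apply/subset_leq_card/fintype.subsetP => _ /codomP[i ->].
apply/familyP => u; rewrite inE ffunE; apply/asboolP; exists (g i) => p ltpn.
by rewrite -[p]/(val (Ordinal ltpn)) -tnth_nth tnth_mktuple.
Qed.

Lemma sep_number_ge1 (R : realType) (X : topologicalType) (I : set X)
    (f : X -> X) (n : nat) (E : set (X * X)) :
  xi I f n !=set0 -> (1 <= sep_number R I f n E)%E.
Proof.
move=> [x xix]; apply: ereal_sup_ubound; exists 1%N => //.
by exists (fun=> x); split=> // i j; rewrite !ord1 eqxx.
Qed.

Definition extend_id (X : Type) (I : set X) (f : X -> X) (x : X) : X :=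
  if `[< I x >] then x else f x.

Lemma extend_id_continuous (X : topologicalType) (I : set X) (f : X -> X) :
  clopen I -> {within ~` I, continuous f} -> continuous (extend_id I f).
Proof.
move=> [oI cI]; rewrite continuous_open_subspace; last exact: closed_openC.
move=> cf x; have [Ix|nIx] := pselect (I x).
  have nI : \near x, id x = extend_id I f x.
    near=> y; rewrite /extend_id asboolT//; near: y.
    by apply: open_nbhs_nbhs; split.
  rewrite /continuous_at {2}/extend_id asboolT//.
  by apply: cvg_trans (@cvg_id _ (nbhs x)); exact: near_eq_cvg nI.
have nI : \near x, f x = extend_id I f x.
  near=> y; rewrite /extend_id asboolF//; near: y.
  by apply: open_nbhs_nbhs; split=> //; exact: closed_openC.
rewrite /continuous_at {2}/extend_id asboolF//.
by apply: cvg_trans (cf x _); [exact: near_eq_cvg nI|rewrite inE].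
Unshelve. all: by end_near. Qed.

Lemma iter_extend_id (X : topologicalType) (I : set X) (f : X -> X)
    (n i : nat) (x : X) :
  xi I f n x -> (i <= n)%N -> iter i (extend_id I f) x = iter i f x.
Proof.
elim: i n x => // i IHi [//|n] x [nIx xifx] lein.
by rewrite !iterSr -(IHi n)// /extend_id asboolF.
Qed.

Lemma limn_esup_sep_number (R : realType) (X : topologicalType)
    (le : X -> X -> Prop) (I : set X) (f : X -> X) (E : set (X * X)) :
  priestley_space le -> noetherian le -> partially_continuous I f -> clopen I ->
  (forall n, xi I f n !=set0) -> sym_entourage E ->
  limn_esup (fun n : nat => ((n%:R)^-1)%:E * lnE (sep_number R I f n E))%E = 0%E.
Proof.
move=> pX nX [_ cf] clI xi0 [Ediag _].
have cF := extend_id_continuous clI cf; set F := extend_id I f in cF.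
have [l cl lE] := clopen_separation pX Ediag.
(* Words have length [n.+1] because Bowen balls compare the times 0 to [n] inclusive. *)
pose M n := (\prod_(u < size l) #|words (nth set0 l u) F n.+1|)%N.
have sepM n : (sep_number R I f n E <= (M n)%:R%:E)%E.
  apply: ge_ereal_sup => _ [m [g [gxi gsep]] <-]; rewrite lee_fin ler_nat.
  apply: (@separated_card_le _ F l n.+1 m g) => i j neij.
  apply: contrapT => nsep; apply: (gsep i j neij); split=> [//|p lepn].
  rewrite -!(@iter_extend_id _ I f n)//; apply: lE => A Al.
  have : itinerary A F (g j) p = itinerary A F (g i) p.
    by apply: contrapT => ne; apply: nsep; exists A, p; split=> //;
      rewrite eq_sym; exact/eqP.
  exact: asbool_eq_equiv.
have /choice[r rP] n : exists r : R,
    [/\ sep_number R I f n E = r%:E, 1 <= r & r <= (M n)%:R].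
  have := sep_number_ge1 R E (xi0 n); have := sepM n.
  by case: (sep_number _ _ _ _ _) => [r| |]//; rewrite !lee_fin => ? ?; exists r.
rewrite (_ : (fun n => _) = EFin \o (fun n => n%:R^-1 * ln (r n))); last first.
  by apply/funext => n; have [-> _ _] := rP n.
suff cv0 : (fun n => n%:R^-1 * ln (r n)) @ \oo --> (0 : R^o).
  by apply: (cvg_limn_einf_sup (l := 0%E) _).2; apply: cvg_EFin => //; exact: nearW.
apply/cvgrPdist_le => eps eps0.
(* The factor 2 absorbs [(n + 1) / n <= 2], and [k.+1] keeps the denominator nonzero when [l] is
   empty. *)
pose k := size l; pose e := eps / (2 * k.+1%:R).
have e0 : 0 < e by rewrite divr_gt0.
have /choice[N0 N0P] (u : 'I_k) : exists N0, forall N, (N0 <= N)%N ->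
    #|words (nth set0 l u) F N|%:R <= expR (e * N%:R).
  by apply: (card_words_le pX nX) => //; apply: cl; rewrite mem_nth.
exists (\max_u N0 u).+1 => // n /= ltn.
have [_ r1 rM] := rP n.
have n0 : (0 : R) < n%:R by rewrite ltr0n (leq_trans _ ltn).
have lnr0 : 0 <= ln (r n) by rewrite ln_ge0.
have Mexp : (M n)%:R <= expR (e * n.+1%:R * k%:R).
  rewrite expRM_natr natr_prod -[k]card_ord -prodr_const; apply: ler_prod => u _.
  rewrite ler0n N0P// (leq_trans _ (leqW (ltnW ltn)))//.
  exact: leq_bigmax.
have lnr : ln (r n) <= e * n.+1%:R * k%:R.
  rewrite -[leRHS]expRK ler_ln ?posrE ?expR_gt0//; last exact: lt_le_trans r1.
  exact: le_trans Mexp.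
rewrite sub0r normrN ger0_norm ?mulr_ge0 ?invr_ge0 ?(ltW n0)//.
rewrite mulrC ler_pdivrMr//; apply: (le_trans lnr).
have epsE : eps = e * (2 * k.+1%:R) by rewrite /e divfK// mulf_neq0.
clearbody e; rewrite epsE.
have n1 : (1 : R) <= n%:R by rewrite ler1n -(ltr0n R).
rewrite -!mulrA ler_pM2l// -[k.+1]addn1 -[n.+1]addn1 !natrD.
have k0 : (0 : R) <= k%:R by [].
(* [k (n - 1) >= 0] supplies the nonlinear part of [(n + 1) k <= 2 (k + 1) n]. *)
have := mulr_ge0 k0 (_ : 0 <= n%:R - 1); rewrite subr_ge0 => /(_ n1).
lra.
Qed.

Theorem theorem3p9 (R : realType) (X : topologicalType) (le : X -> X -> Prop) :
  priestley_space le -> noetherian le ->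
  (forall (I : set X) (f : X -> X),
      partially_continuous I f -> clopen I ->
      (forall n, xi I f n !=set0) ->
      htop R I f = 0%E) /\
  (forall f : X -> X, continuous f -> [set: X] !=set0 ->
      htop R set0 f = 0%E).
Proof.
move=> pX nX.
have partial (I : set X) (f : X -> X) : partially_continuous I f -> clopen I ->
    (forall n, xi I f n !=set0) -> htop R I f = 0%E.
  move=> pcf clI xi0; rewrite /htop asboolF; last first.
    by move=> [n xin]; have := xi0 n; rewrite xin => -[].
  rewrite (_ : [set _ | _ in _] = [set 0%E]) ?ereal_sup1//.
  apply/seteqP; split=> [_ [E symE <-]|_ ->].
    exact: (limn_esup_sep_number R pX nX pcf clI xi0 symE).
  (* The full square shows that the supremum is over a non-empty set, so that set is exactly the
     singleton of 0. *)
  have symT : sym_entourage [set: X * X] by split=> // x; exact: filterT.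
  exists setT => //; exact: (limn_esup_sep_number R pX nX pcf clI xi0 symT).
split=> // f cf [x _]; apply: partial.
- by split; [exact: closed0|exact: continuous_subspaceT].
- exact: clopen0.
- by move=> n; exists x; elim: n x => // n IHn x; split=> //=.
Qed.
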